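(* Let $\mathsf{B}$ be a bicategory. Then the following data form a bicategory $\mathsf{W}(\mathsf{B})$. $\bullet$ $0$-cells: all $0$-cells of $\mathsf{B}$. $\bullet$ $1$-cells from $B$ to $A$: four-tuples $\Gamma=(f,g,\eta,\rho)$ consisting of two $1$-cells $f\in{}_A\mathsf{B}_B$ and $g\in{}_B\mathsf{B}_A$, and two $2$-cells $\eta:fg\to\mathbb{I}_A$ and $\rho:gf\to\mathbb{I}_B$ satisfying $$\mathfrak{r}_g\circ(1_g\,\eta)\circ\mathfrak{a}_{g,f,g}=\mathfrak{l}_g\circ(\rho\,1_g),\qquad \mathfrak{l}_f\circ(\eta\,1_f)=\mathfrak{r}_f\circ(1_f\,\rho)\circ\mathfrak{a}_{f,g,f}.$$ The identity $1$-cell of $A$ is the four-tuple $\overline{\mathbb{I}}_A=(\mathbb{I}_A,\mathbb{I}_A,\mathfrak{r}_{\mathbb{I}_A},\mathfrak{l}_{\mathbb{I}_A})$. $\bullet$ $2$-cells $\Gamma=(f,g,\eta,\rho)\to\Gamma'=(f',g',\eta',\rho')$: pairs $(\alpha,\beta)$ consisting of two $2$-cells $\alpha:f\to f'$ and $\beta:g\to g'$ of $\mathsf{B}$ such that $\eta'\circ(\alpha\beta)=\eta$ and $\rho'\circ(\beta\alpha)=\rho$. Here the composition of $2$-cells, the multiplication of $1$-cells and $2$-cells, and the associativity and identity constraints are those given in the context.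
   Context: Conventions for bicategories. A bicategory $\mathsf{B}$ has a class of $0$-cells; for each pair of $0$-cells $A,B$ a category ${}_A\mathsf{B}_B$, whose objects are the $1$-cells from $B$ to $A$ and whose morphisms are the $2$-cells (composition in this category is written $\circ$); multiplication functors ${}_A\mathsf{B}_B\times{}_B\mathsf{B}_C\to{}_A\mathsf{B}_C$, $(f,g)\mapsto fg$ on $1$-cells and $(\alpha,\beta)\mapsto\alpha\beta$ on $2$-cells; identity $1$-cells $\mathbb{I}_A\in{}_A\mathsf{B}_A$; and natural isomorphisms $\mathfrak{a}_{f,g,h}:(fg)h\to f(gh)$, $\mathfrak{r}_f:f\mathbb{I}_B\to f$, $\mathfrak{l}_f:\mathbb{I}_Af\to f$ satisfying the usual pentagon and triangle axioms. $1_f$ denotes the identity $2$-cell of $f$. Remaining structure of $\mathsf{W}(\mathsf{B})$. Composition of $2$-cells is componentwise, $(\alpha',\beta')\circ(\alpha,\beta)=(\alpha'\circ\alpha,\beta'\circ\beta)$, with identities $(1_f,1_g)$. Multiplication: for a $1$-cell $\Gamma=(f,g,\eta,\rho)$ from $B$ to $A$ and a $1$-cell $\Lambda=(p,q,\gamma,\mu)$ from $C$ to $B$ (so $\gamma:pq\to\mathbb{I}_B$, $\mu:qp\to\mathbb{I}_C$), $\Gamma\Lambda=(fp,\,qg,\,\eta\ast\gamma,\,\mu\ast\rho)$, where $$\eta\ast\gamma=\eta\circ(1_f\,\mathfrak{l}_g)\circ(1_f(\gamma\,1_g))\circ(1_f\,\mathfrak{a}^{-1}_{p,q,g})\circ\mathfrak{a}_{f,p,qg}:(fp)(qg)\to\mathbb{I}_A,$$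 $$\mu\ast\rho=\mu\circ(1_q\,\mathfrak{l}_p)\circ(1_q(\rho\,1_p))\circ(1_q\,\mathfrak{a}^{-1}_{g,f,p})\circ\mathfrak{a}_{q,g,fp}:(qg)(fp)\to\mathbb{I}_C.$$ On $2$-cells, $(\alpha,\beta)(\varsigma,\tau)=(\alpha\varsigma,\tau\beta)$. Constraints: for $\Gamma=(f,g,\eta,\rho)$, $\Lambda=(p,q,\gamma,\mu)$, $\Omega=(u,v,\theta,\sigma)$ composable $1$-cells, the associativity constraint is $\overline{\mathfrak{a}}_{\Gamma\Lambda\Omega}=(\mathfrak{a}_{f,p,u},\mathfrak{a}^{-1}_{v,q,g}):(\Gamma\Lambda)\Omega\to\Gamma(\Lambda\Omega)$; the right and left identity constraints are $\overline{\mathfrak{r}}_\Gamma=(\mathfrak{r}_f,\mathfrak{l}_g):\Gamma\overline{\mathbb{I}}_B\to\Gamma$ and $\overline{\mathfrak{l}}_\Gamma=(\mathfrak{l}_f,\mathfrak{r}_g):\overline{\mathbb{I}}_A\Gamma\to\Gamma$. *)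

(* Defs.v *)
Set Implicit Arguments.
Unset Strict Implicit.
Unset Printing Implicit Defensive.

Declare Scope bicat_scope.
Delimit Scope bicat_scope with bicat.

(* [cell1 A B] is the type of 1-cells from B to A, so [mul1] composes
   [cell1 A B] with [cell1 B C].  The components of the constraints and those
   of their inverses are both part of the data; that they are mutually inverse
   is an axiom of [is_bicategory]. *)
Record bicat_data : Type := BicatData {
  cell0 :> Type;
  cell1 : cell0 -> cell0 -> Type;
  cell2 : forall A B : cell0, cell1 A B -> cell1 A B -> Type;
  id2 : forall (A B : cell0) (f : cell1 A B), cell2 f f;
  comp2 : forall (A B : cell0) (f g h : cell1 A B),
    cell2 g h -> cell2 f g -> cell2 f h;
  id1 : forall A : cell0, cell1 A A;
  mul1 : forall A B C : cell0, cell1 A B -> cell1 B C -> cell1 A C;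
  mul2 : forall (A B C : cell0) (f f' : cell1 A B) (g g' : cell1 B C),
    cell2 f f' -> cell2 g g' -> cell2 (mul1 f g) (mul1 f' g');
  assoc : forall (A B C D : cell0)
    (f : cell1 A B) (g : cell1 B C) (h : cell1 C D),
    cell2 (mul1 (mul1 f g) h) (mul1 f (mul1 g h));
  assoc_inv : forall (A B C D : cell0)
    (f : cell1 A B) (g : cell1 B C) (h : cell1 C D),
    cell2 (mul1 f (mul1 g h)) (mul1 (mul1 f g) h);
  runit : forall (A B : cell0) (f : cell1 A B), cell2 (mul1 f (id1 B)) f;
  runit_inv : forall (A B : cell0) (f : cell1 A B), cell2 f (mul1 f (id1 B));
  lunit : forall (A B : cell0) (f : cell1 A B), cell2 (mul1 (id1 A) f) f;
  lunit_inv : forall (A B : cell0) (f : cell1 A B), cell2 f (mul1 (id1 A) f)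
}.

Arguments cell1 {b} A B.
Arguments cell2 {b A B} f g.
Arguments id2 {b A B} f.
Arguments comp2 {b A B f g h} _ _.
Arguments id1 {b} A.
Arguments mul1 {b A B C} f g.
Arguments mul2 {b A B C f f' g g'} _ _.
Arguments assoc {b A B C D} f g h.
Arguments assoc_inv {b A B C D} f g h.
Arguments runit {b A B} f.
Arguments runit_inv {b A B} f.
Arguments lunit {b A B} f.
Arguments lunit_inv {b A B} f.

Notation "f · g" := (mul1 f g) (at level 40, left associativity) : bicat_scope.
Notation "a ⊠ b" := (mul2 a b) (at level 40, left associativity) : bicat_scope.
Notation "b ∘ a" := (comp2 b a) (at level 50, left associativity) : bicat_scope.
Notation "f ⇒ g" := (cell2 f g) (at level 70, no associativity) : bicat_scope.
Notation "'𝕀' A" := (id1 A) (at level 10, A at level 9) : bicat_scope.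
Notation "'𝟏' f" := (id2 f) (at level 10, f at level 9) : bicat_scope.

Open Scope bicat_scope.

Record is_bicategory (B : bicat_data) : Prop := IsBicategory {
  comp2A : forall (X Y : B) (f g h k : cell1 X Y)
    (c : h ⇒ k) (b : g ⇒ h) (a : f ⇒ g), c ∘ (b ∘ a) = (c ∘ b) ∘ a;
  comp2_idl : forall (X Y : B) (f g : cell1 X Y) (a : f ⇒ g), 𝟏 g ∘ a = a;
  comp2_idr : forall (X Y : B) (f g : cell1 X Y) (a : f ⇒ g), a ∘ 𝟏 f = a;

  mul2_id : forall (X Y Z : B) (f : cell1 X Y) (g : cell1 Y Z),
    𝟏 f ⊠ 𝟏 g = 𝟏 (f · g);
  mul2_comp : forall (X Y Z : B) (f f' f'' : cell1 X Y) (g g' g'' : cell1 Y Z)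
    (a' : f' ⇒ f'') (a : f ⇒ f') (b' : g' ⇒ g'') (b : g ⇒ g'),
    (a' ∘ a) ⊠ (b' ∘ b) = (a' ⊠ b') ∘ (a ⊠ b);

  assoc_nat : forall (X Y Z T : B)
    (f f' : cell1 X Y) (g g' : cell1 Y Z) (h h' : cell1 Z T)
    (a : f ⇒ f') (b : g ⇒ g') (c : h ⇒ h'),
    assoc f' g' h' ∘ ((a ⊠ b) ⊠ c) = (a ⊠ (b ⊠ c)) ∘ assoc f g h;
  assocK : forall (X Y Z T : B)
    (f : cell1 X Y) (g : cell1 Y Z) (h : cell1 Z T),
    assoc_inv f g h ∘ assoc f g h = 𝟏 ((f · g) · h);
  assocVK : forall (X Y Z T : B)
    (f : cell1 X Y) (g : cell1 Y Z) (h : cell1 Z T),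
    assoc f g h ∘ assoc_inv f g h = 𝟏 (f · (g · h));

  runit_nat : forall (X Y : B) (f f' : cell1 X Y) (a : f ⇒ f'),
    runit f' ∘ (a ⊠ 𝟏 (𝕀 Y)) = a ∘ runit f;
  runitK : forall (X Y : B) (f : cell1 X Y),
    runit_inv f ∘ runit f = 𝟏 (f · 𝕀 Y);
  runitVK : forall (X Y : B) (f : cell1 X Y), runit f ∘ runit_inv f = 𝟏 f;

  lunit_nat : forall (X Y : B) (f f' : cell1 X Y) (a : f ⇒ f'),
    lunit f' ∘ (𝟏 (𝕀 X) ⊠ a) = a ∘ lunit f;
  lunitK : forall (X Y : B) (f : cell1 X Y),
    lunit_inv f ∘ lunit f = 𝟏 (𝕀 X · f);
  lunitVK : forall (X Y : B) (f : cell1 X Y), lunit f ∘ lunit_inv f = 𝟏 f;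

  pentagon : forall (X Y Z T U : B) (f : cell1 X Y) (g : cell1 Y Z)
    (h : cell1 Z T) (k : cell1 T U),
    assoc f g (h · k) ∘ assoc (f · g) h k
    = (𝟏 f ⊠ assoc g h k) ∘ assoc f (g · h) k ∘ (assoc f g h ⊠ 𝟏 k);
  triangle : forall (X Y Z : B) (f : cell1 X Y) (g : cell1 Y Z),
    (𝟏 f ⊠ lunit g) ∘ assoc f (𝕀 Y) g = runit f ⊠ 𝟏 g
}.

Record bicategory : Type := Bicategory {
  bicat_data_of :> bicat_data;
  bicategoryP : is_bicategory bicat_data_of
}.

(* Four-tuples (f, g, η, ρ) not yet subject to the two compatibility
   conditions. *)
Record quad (B : bicat_data) (X Y : B) : Type := Quad {
  qf : cell1 X Y;
  qg : cell1 Y X;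
  qeta : qf · qg ⇒ 𝕀 X;
  qrho : qg · qf ⇒ 𝕀 Y
}.

Definition is_wcell1 (B : bicat_data) (X Y : B) (x : quad X Y) : Prop :=
  let f := qf x in let g := qg x in
  runit g ∘ (𝟏 g ⊠ qeta x) ∘ assoc g f g = lunit g ∘ (qrho x ⊠ 𝟏 g)
  /\ lunit f ∘ (qeta x ⊠ 𝟏 f) = runit f ∘ (𝟏 f ⊠ qrho x) ∘ assoc f g f.

Record wcell1 (B : bicat_data) (X Y : B) : Type := WCell1 {
  wquad :> quad X Y;
  wcell1P : is_wcell1 wquad
}.

Definition is_wcell2 (B : bicat_data) (X Y : B) (x x' : quad X Y)
    (a : qf x ⇒ qf x') (b : qg x ⇒ qg x') : Prop :=
  qeta x' ∘ (a ⊠ b) = qeta x /\ qrho x' ∘ (b ⊠ a) = qrho x.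

Record wcell2 (B : bicat_data) (X Y : B) (x x' : wcell1 X Y) : Type := WCell2 {
  wa : qf x ⇒ qf x';
  wb : qg x ⇒ qg x';
  wcell2P : is_wcell2 wa wb
}.

Definition quad_id (B : bicat_data) (X : B) : quad X X :=
  @Quad B X X (𝕀 X) (𝕀 X) (runit (𝕀 X)) (lunit (𝕀 X)).

(* The 2-cell η * γ of the multiplication; μ * ρ is [star] with the roles of
   (f, g, η) and (p, q, γ) played by (q, p, μ) and (g, f, ρ). *)
Definition star (B : bicat_data) (X Y Z : B)
    (f : cell1 X Y) (g : cell1 Y X) (eta : f · g ⇒ 𝕀 X)
    (p : cell1 Y Z) (q : cell1 Z Y) (gamma : p · q ⇒ 𝕀 Y) :
    (f · p) · (q · g) ⇒ 𝕀 X :=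
  eta ∘ (𝟏 f ⊠ lunit g) ∘ (𝟏 f ⊠ (gamma ⊠ 𝟏 g)) ∘ (𝟏 f ⊠ assoc_inv p q g)
  ∘ assoc f p (q · g).

Definition quad_mul (B : bicat_data) (X Y Z : B)
    (x : quad X Y) (y : quad Y Z) : quad X Z :=
  @Quad B X Z (qf x · qf y) (qg y · qg x)
    (star (qeta x) (qeta y)) (star (qrho y) (qrho x)).

(* Well-definedness of the structure of W(B): every four-tuple, resp. pair of
   2-cells, entering its definition is a 1-cell, resp. 2-cell, of W(B). *)
Record W_closed (B : bicat_data) : Prop := WClosed {
  W_id1P : forall X : B, is_wcell1 (quad_id X);
  W_mul1P : forall (X Y Z : B) (x : wcell1 X Y) (y : wcell1 Y Z),
    is_wcell1 (quad_mul x y);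
  W_id2P : forall (X Y : B) (x : wcell1 X Y),
    is_wcell2 (x := x) (x' := x) (𝟏 (qf x)) (𝟏 (qg x));
  W_comp2P : forall (X Y : B) (x y z : wcell1 X Y)
    (t : wcell2 y z) (s : wcell2 x y),
    is_wcell2 (x := x) (x' := z) (wa t ∘ wa s) (wb t ∘ wb s);
  W_mul2P : forall (X Y Z : B) (x x' : wcell1 X Y) (y y' : wcell1 Y Z)
    (s : wcell2 x x') (t : wcell2 y y'),
    is_wcell2 (x := quad_mul x y) (x' := quad_mul x' y')
      (wa s ⊠ wa t) (wb t ⊠ wb s);
  W_assocP : forall (X Y Z T : B)
    (x : wcell1 X Y) (y : wcell1 Y Z) (z : wcell1 Z T),
    is_wcell2 (x := quad_mul (quad_mul x y) z)
      (x' := quad_mul x (quad_mul y z))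
      (assoc (qf x) (qf y) (qf z)) (assoc_inv (qg z) (qg y) (qg x));
  W_assoc_invP : forall (X Y Z T : B)
    (x : wcell1 X Y) (y : wcell1 Y Z) (z : wcell1 Z T),
    is_wcell2 (x := quad_mul x (quad_mul y z))
      (x' := quad_mul (quad_mul x y) z)
      (assoc_inv (qf x) (qf y) (qf z)) (assoc (qg z) (qg y) (qg x));
  W_runitP : forall (X Y : B) (x : wcell1 X Y),
    is_wcell2 (x := quad_mul x (quad_id Y)) (x' := x)
      (runit (qf x)) (lunit (qg x));
  W_runit_invP : forall (X Y : B) (x : wcell1 X Y),
    is_wcell2 (x := x) (x' := quad_mul x (quad_id Y))
      (runit_inv (qf x)) (lunit_inv (qg x));
  W_lunitP : forall (X Y : B) (x : wcell1 X Y),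
    is_wcell2 (x := quad_mul (quad_id X) x) (x' := x)
      (lunit (qf x)) (runit (qg x));
  W_lunit_invP : forall (X Y : B) (x : wcell1 X Y),
    is_wcell2 (x := x) (x' := quad_mul (quad_id X) x)
      (lunit_inv (qf x)) (runit_inv (qg x))
}.

Definition W_data (B : bicat_data) (H : W_closed B) : bicat_data :=
  let id1W (X : B) := WCell1 (W_id1P H X) in
  let mul1W (X Y Z : B) (x : wcell1 X Y) (y : wcell1 Y Z) :=
    WCell1 (W_mul1P H x y) in
  @BicatData
    B
    (@wcell1 B)
    (@wcell2 B)
    (fun X Y x => @WCell2 B X Y x x _ _ (W_id2P H x))
    (fun X Y x y z t s => @WCell2 B X Y x z _ _ (W_comp2P H t s))
    id1W
    mul1W
    (fun X Y Z x x' y y' s t =>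
       @WCell2 B X Z (mul1W X Y Z x y) (mul1W X Y Z x' y') _ _
         (W_mul2P H s t))
    (fun X Y Z T x y z =>
       @WCell2 B X T (mul1W X Z T (mul1W X Y Z x y) z)
         (mul1W X Y T x (mul1W Y Z T y z)) _ _ (W_assocP H x y z))
    (fun X Y Z T x y z =>
       @WCell2 B X T (mul1W X Y T x (mul1W Y Z T y z))
         (mul1W X Z T (mul1W X Y Z x y) z) _ _ (W_assoc_invP H x y z))
    (fun X Y x =>
       @WCell2 B X Y (mul1W X Y Y x (id1W Y)) x _ _ (W_runitP H x))
    (fun X Y x =>
       @WCell2 B X Y x (mul1W X Y Y x (id1W Y)) _ _ (W_runit_invP H x))
    (fun X Y x =>
       @WCell2 B X Y (mul1W X X Y (id1W X) x) x _ _ (W_lunitP H x))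
    (fun X Y x =>
       @WCell2 B X Y x (mul1W X X Y (id1W X) x) _ _ (W_lunit_invP H x)).

(* Main.v *)
From Stdlib Require Import ssreflect ProofIrrelevance.
Require Import Defs.

(* Write [hat η x : f·(g·x) ⇒ x] for the action of [η : f·g ⇒ 𝕀] on a 1-cell
[x].  Since [η] is determined by [hat η 𝕀], identities can be checked on
actions, where every composite of 1-cells is bracketed to the right.  There,
[hat (star η γ) x] is [hat η x] after [f·hat γ (g·x)], and the compatibility
condition on [(f, g, η, ρ)] becomes [hat η (f·x) = f·hat ρ x].  Hence the
associativity of [star] is plain associativity of composition, and the product
of two 1-cells satisfies the compatibility condition by
[hat η (f·p·x) ∘ f·hat γ (g·f·p·x) = f·hat ρ (p·x) ∘ f·hat γ (g·f·p·x)
= f·hat γ (p·x) ∘ f·p·q·hat ρ (p·x) = f·p·hat μ x ∘ f·p·q·hat ρ (p·x)]. *)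

Set Implicit Arguments.
Unset Strict Implicit.
Unset Printing Implicit Defensive.

Section Coherence.
Context (B : bicat_data) (hB : is_bicategory B).

(** * Rewriting and cancellation for composites of 2-cells *)

(** Composites are kept bracketed to the left, so rewriting two adjacent factors must allow for a
    prefix [d]. The digit in the name counts the factors that replace them. *)
Lemma comp2_eq2 (X Y : B) (f g g' h k : cell1 X Y)
    (c : g ⇒ h) (a : f ⇒ g) (c' : g' ⇒ h) (a' : f ⇒ g') :
  c ∘ a = c' ∘ a' -> forall d : h ⇒ k, d ∘ c ∘ a = d ∘ c' ∘ a'.
Proof. by move=> e d; rewrite -!(comp2A hB) e. Qed.

Lemma comp2_eq1 (X Y : B) (f g h k : cell1 X Y)
    (c : g ⇒ h) (a : f ⇒ g) (b : f ⇒ h) :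
  c ∘ a = b -> forall d : h ⇒ k, d ∘ c ∘ a = d ∘ b.
Proof. by move=> e d; rewrite -!(comp2A hB) e. Qed.

Lemma comp2_eq3 (X Y : B) (f g1 g2 g3 h k : cell1 X Y)
    (c : g1 ⇒ h) (a : f ⇒ g1) (c3 : g3 ⇒ h) (c2 : g2 ⇒ g3) (c1 : f ⇒ g2) :
  c ∘ a = c3 ∘ c2 ∘ c1 ->
  forall d : h ⇒ k, d ∘ c ∘ a = d ∘ c3 ∘ c2 ∘ c1.
Proof. by move=> e d; rewrite -!(comp2A hB) e -!(comp2A hB). Qed.

Lemma comp2_epi (X Y : B) (f g h : cell1 X Y) (c c' : g ⇒ h)
    (i : f ⇒ g) (j : g ⇒ f) :
  i ∘ j = 𝟏 g -> c ∘ i = c' ∘ i -> c = c'.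
Proof.
move=> ij e; rewrite -(comp2_idr hB c) -(comp2_idr hB c') -ij.
by rewrite !(comp2A hB) e.
Qed.

Lemma comp2_mono (X Y : B) (f g h : cell1 X Y) (c c' : f ⇒ g)
    (i : g ⇒ h) (j : h ⇒ g) :
  j ∘ i = 𝟏 g -> i ∘ c = i ∘ c' -> c = c'.
Proof.
move=> ji e; rewrite -(comp2_idl hB c) -(comp2_idl hB c') -ji.
by rewrite -!(comp2A hB) e.
Qed.

Lemma mul2_compl (X Y Z : B) (f : cell1 X Y) (g g' g'' : cell1 Y Z)
    (b' : g' ⇒ g'') (b : g ⇒ g') :
  𝟏 f ⊠ (b' ∘ b) = (𝟏 f ⊠ b') ∘ (𝟏 f ⊠ b).
Proof. by rewrite -(mul2_comp hB) (comp2_idl hB). Qed.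

Lemma mul2_compr (X Y Z : B) (f f' f'' : cell1 X Y) (g : cell1 Y Z)
    (a' : f' ⇒ f'') (a : f ⇒ f') :
  (a' ∘ a) ⊠ 𝟏 g = (a' ⊠ 𝟏 g) ∘ (a ⊠ 𝟏 g).
Proof. by rewrite -(mul2_comp hB) (comp2_idl hB). Qed.

Lemma mul2_swap (X Y Z : B) (f f' : cell1 X Y) (g g' : cell1 Y Z)
    (a : f ⇒ f') (b : g ⇒ g') :
  (a ⊠ 𝟏 g') ∘ (𝟏 f ⊠ b) = (𝟏 f' ⊠ b) ∘ (a ⊠ 𝟏 g).
Proof. by rewrite -!(mul2_comp hB) !(comp2_idl hB) !(comp2_idr hB). Qed.

Lemma mul2_iso (X Y Z : B) (f f' : cell1 X Y) (g g' : cell1 Y Z)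
    (a : f ⇒ f') (a' : f' ⇒ f) (b : g ⇒ g') (b' : g' ⇒ g) :
  a ∘ a' = 𝟏 f' -> b ∘ b' = 𝟏 g' -> (a ⊠ b) ∘ (a' ⊠ b') = 𝟏 (f' · g').
Proof. by move=> ea eb; rewrite -(mul2_comp hB) ea eb (mul2_id hB). Qed.

Lemma assoc_natl (X Y Z T : B) (f f' : cell1 X Y) (g : cell1 Y Z)
    (h : cell1 Z T) (a : f ⇒ f') :
  assoc f' g h ∘ ((a ⊠ 𝟏 g) ⊠ 𝟏 h) = (a ⊠ 𝟏 (g · h)) ∘ assoc f g h.
Proof. by rewrite (assoc_nat hB) (mul2_id hB). Qed.

Lemma assoc_natr (X Y Z T : B) (f : cell1 X Y) (g : cell1 Y Z)
    (h h' : cell1 Z T) (a : h ⇒ h') :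
  assoc f g h' ∘ (𝟏 (f · g) ⊠ a) = (𝟏 f ⊠ (𝟏 g ⊠ a)) ∘ assoc f g h.
Proof. by rewrite -(mul2_id hB) (assoc_nat hB). Qed.

Lemma assoc_inv_nat (X Y Z T : B)
    (f f' : cell1 X Y) (g g' : cell1 Y Z) (h h' : cell1 Z T)
    (a : f ⇒ f') (b : g ⇒ g') (c : h ⇒ h') :
  assoc_inv f' g' h' ∘ (a ⊠ (b ⊠ c)) = ((a ⊠ b) ⊠ c) ∘ assoc_inv f g h.
Proof.
apply: (comp2_epi (assocVK hB f g h)).
rewrite -(comp2A hB) -(assoc_nat hB) -(comp2A hB) (assocK hB) (comp2A hB).
by rewrite (assocK hB) (comp2_idl hB) (comp2_idr hB).
Qed.

(** This is the second component of the pentagon of W(B), whose associator has [assoc_inv] there. *)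
Lemma pentagon_inv (X Y Z T U : B) (f : cell1 X Y) (g : cell1 Y Z)
    (h : cell1 Z T) (k : cell1 T U) :
  assoc_inv (f · g) h k ∘ assoc_inv f g (h · k)
  = (assoc_inv f g h ⊠ 𝟏 k) ∘ assoc_inv f (g · h) k ∘ (𝟏 f ⊠ assoc_inv g h k).
Proof.
apply: (comp2_mono (assocK hB (f · g) h k)).
apply: (comp2_mono (assocK hB f g (h · k))).
rewrite !(comp2A hB) [in RHS](pentagon hB) (comp2_eq1 (assocVK hB _ _ _)).
rewrite (comp2_idr hB) (assocVK hB).
rewrite (comp2_eq1 (mul2_iso (assocVK hB _ _ _) (comp2_idl hB (𝟏 k)))).
rewrite (comp2_idr hB) (comp2_eq1 (assocVK hB _ _ _)) (comp2_idr hB).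
by rewrite mul2_iso ?(comp2_idl hB) ?(assocVK hB).
Qed.

(** * Kelly's consequences of the pentagon and triangle axioms *)

Lemma mul2_id1_injr (X Y : B) (f g : cell1 X Y) (a b : f ⇒ g) :
  a ⊠ 𝟏 (𝕀 Y) = b ⊠ 𝟏 (𝕀 Y) -> a = b.
Proof.
by move=> e; apply: (comp2_epi (runitVK hB f)); rewrite -!(runit_nat hB) e.
Qed.

Lemma mul2_id1_injl (X Y : B) (f g : cell1 X Y) (a b : f ⇒ g) :
  𝟏 (𝕀 X) ⊠ a = 𝟏 (𝕀 X) ⊠ b -> a = b.
Proof.
by move=> e; apply: (comp2_epi (lunitVK hB f)); rewrite -!(lunit_nat hB) e.
Qed.

(** After multiplying by [𝕀 X] on the left, this is the pentagon for [𝕀 X], [𝕀 X], [f], [g] with the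
    unit constraints absorbed by the triangle. [runit_mul] is the mirror image. *)
Lemma lunit_mul (X Y Z : B) (f : cell1 X Y) (g : cell1 Y Z) :
  lunit (f · g) ∘ assoc (𝕀 X) f g = lunit f ⊠ 𝟏 g.
Proof.
apply: mul2_id1_injl.
apply: (comp2_epi (assocVK hB (𝕀 X) (𝕀 X · f) g)).
apply: (comp2_epi (mul2_iso (assocVK hB (𝕀 X) (𝕀 X) f) (comp2_idl hB (𝟏 g)))).
rewrite mul2_compl -[LHS](comp2A hB) -[LHS](comp2A hB) [X in _ ∘ X](comp2A hB).
rewrite -(pentagon hB) (comp2A hB) (triangle hB).
rewrite -(assoc_nat hB) -(comp2A hB) -mul2_compr (triangle hB).
by rewrite (assoc_nat hB) (mul2_id hB).
Qed.

Lemma runit_mul (X Y Z : B) (f : cell1 X Y) (g : cell1 Y Z) :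
  (𝟏 f ⊠ runit g) ∘ assoc f g (𝕀 Z) = runit (f · g).
Proof.
apply: mul2_id1_injr; rewrite mul2_compr -(triangle hB).
apply: (comp2_mono (assocK hB f g (𝕀 Z))).
rewrite !(comp2A hB) (assoc_nat hB) -(triangle hB) mul2_compl.
rewrite -[LHS](comp2A hB) -[LHS](comp2A hB) [X in _ ∘ X](comp2A hB).
by rewrite -(pentagon hB) !(comp2A hB) -assoc_natr.
Qed.

(** The triangle and [lunit_mul] reduce this to [𝟏 ⊠ lunit (𝕀 X) = lunit (𝕀 X · 𝕀 X)], which is
    naturality of [lunit] at the invertible 2-cell [lunit (𝕀 X)]. *)
Lemma lunit_id1 (X : B) : lunit (𝕀 X) = runit (𝕀 X).
Proof.
apply: mul2_id1_injr; rewrite -(triangle hB) -lunit_mul; congr (_ ∘ _).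
by apply: (comp2_mono (lunitK hB (𝕀 X))); rewrite (lunit_nat hB).
Qed.

(* Locked, because rewriting with [comp2A] would otherwise see through it. *)
Definition hat (X Y Z : B) (f : cell1 X Y) (g : cell1 Y X) (eta : f · g ⇒ 𝕀 X)
    (x : cell1 X Z) : f · (g · x) ⇒ x :=
  locked (lunit x ∘ (eta ⊠ 𝟏 x) ∘ assoc_inv f g x).

(** * Laws of the action of a 2-cell into an identity *)

Section Hat.
Context (X Y : B) (f : cell1 X Y) (g : cell1 Y X) (eta : f · g ⇒ 𝕀 X).

Lemma hat_assoc (Z : B) (x : cell1 X Z) :
  hat eta x ∘ assoc f g x = lunit x ∘ (eta ⊠ 𝟏 x).
Proof. by rewrite /hat -!lock (comp2_eq1 (assocK hB _ _ _)) (comp2_idr hB). Qed.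

Lemma hat_nat (Z : B) (x x' : cell1 X Z) (a : x ⇒ x') :
  hat eta x' ∘ (𝟏 f ⊠ (𝟏 g ⊠ a)) = a ∘ hat eta x.
Proof.
rewrite /hat -!lock (comp2_eq2 (assoc_inv_nat _ _ _)) (mul2_id hB).
by rewrite (comp2_eq2 (mul2_swap _ _)) (lunit_nat hB) !(comp2A hB).
Qed.

Lemma hat_comp (f' : cell1 X Y) (g' : cell1 Y X) (a : f' ⇒ f) (b : g' ⇒ g)
    (Z : B) (x : cell1 X Z) :
  hat (eta ∘ (a ⊠ b)) x = hat eta x ∘ (a ⊠ (b ⊠ 𝟏 x)).
Proof.
by rewrite /hat -!lock (comp2_eq2 (assoc_inv_nat _ _ _)) mul2_compr !(comp2A hB).
Qed.

Lemma hat_inj (eta' : f · g ⇒ 𝕀 X) :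
  hat eta (𝕀 X) = hat eta' (𝕀 X) -> eta = eta'.
Proof.
move=> e; apply: mul2_id1_injr; apply: (comp2_mono (lunitK hB (𝕀 X))).
by move: e; rewrite /hat -!lock; apply: (comp2_epi (assocK hB f g (𝕀 X))).
Qed.

End Hat.

Lemma starE (X Y Z : B) (f : cell1 X Y) (g : cell1 Y X) (eta : f · g ⇒ 𝕀 X)
    (p : cell1 Y Z) (q : cell1 Z Y) (gamma : p · q ⇒ 𝕀 Y) :
  star eta gamma = eta ∘ (𝟏 f ⊠ hat gamma g) ∘ assoc f p (q · g).
Proof. by rewrite /star /hat -!lock !mul2_compl !(comp2A hB). Qed.

(** The pentagon accounts for the associators and [lunit_mul] for the unit constraint. *)
Lemma hat_mul (X Y Z T : B) (f : cell1 X Y) (g : cell1 Y X)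
    (eta : f · g ⇒ 𝕀 X) (x : cell1 X Z) (y : cell1 Z T) :
  hat eta x ⊠ 𝟏 y
  = hat eta (x · y) ∘ (𝟏 f ⊠ assoc g x y) ∘ assoc f (g · x) y.
Proof.
apply: (comp2_epi (mul2_iso (assocVK hB f g x) (comp2_idl hB (𝟏 y)))).
rewrite -mul2_compr hat_assoc mul2_compr -lunit_mul.
rewrite (comp2_eq2 (assoc_natl _ _ _)) -hat_assoc.
by rewrite (comp2_eq3 (pentagon hB _ _ _ _)).
Qed.

Lemma hat_star (X Y Z T : B)
    (f : cell1 X Y) (g : cell1 Y X) (eta : f · g ⇒ 𝕀 X)
    (p : cell1 Y Z) (q : cell1 Z Y) (gamma : p · q ⇒ 𝕀 Y) (x : cell1 X T) :
  hat (star eta gamma) x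
  = hat eta x ∘ (𝟏 f ⊠ hat gamma (g · x)) ∘ (𝟏 f ⊠ (𝟏 p ⊠ assoc q g x))
    ∘ assoc f p ((q · g) · x).
Proof.
apply: (comp2_epi (assocVK hB (f · p) (q · g) x)).
rewrite hat_assoc starE !mul2_compr !(comp2A hB) -hat_assoc.
(* The factor [hat gamma g ⊠ 𝟏 x] becomes the action on [g · x]. *)
rewrite (comp2_eq2 (assoc_nat hB _ _ _)) hat_mul !mul2_compl !(comp2A hB).
by rewrite (comp2_eq3 (pentagon hB _ _ _ _)).
Qed.

(** * The compatibility condition and its stability under products *)

(** Exchanging [(f, eta)] with [(g, rho)] gives the other condition on a four-tuple, so one argument
    serves both. *)
Definition compatible (X Y : B) (f : cell1 X Y) (g : cell1 Y X)
    (eta : f · g ⇒ 𝕀 X) (rho : g · f ⇒ 𝕀 Y) : Prop :=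
  lunit f ∘ (eta ⊠ 𝟏 f) = runit f ∘ (𝟏 f ⊠ rho) ∘ assoc f g f.

Lemma compatibleE (X Y : B) (f : cell1 X Y) (g : cell1 Y X)
    (eta : f · g ⇒ 𝕀 X) (rho : g · f ⇒ 𝕀 Y) :
  compatible eta rho <-> hat eta f = runit f ∘ (𝟏 f ⊠ rho).
Proof.
rewrite /compatible -hat_assoc; split=> [|->] //.
exact: (comp2_epi (assocVK hB f g f)).
Qed.

(** Multiply [compatibleE] by [x] on the right: [hat_mul] rewrites one side, and the triangle
    removes [runit f] from the other. The converse takes [x] to be [𝕀 Y], where this multiplication
    is injective. *)
Lemma compatible_hatP (X Y : B) (f : cell1 X Y) (g : cell1 Y X)
    (eta : f · g ⇒ 𝕀 X) (rho : g · f ⇒ 𝕀 Y) :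
  compatible eta rho <->
  forall (Z : B) (x : cell1 Y Z), hat eta (f · x) = 𝟏 f ⊠ hat rho x.
Proof.
have rhoE Z (x : cell1 Y Z) : (runit f ∘ (𝟏 f ⊠ rho)) ⊠ 𝟏 x
    = (𝟏 f ⊠ hat rho x) ∘ (𝟏 f ⊠ assoc g f x) ∘ assoc f (g · f) x.
  rewrite mul2_compr -(triangle hB) (comp2_eq2 (assoc_nat hB _ _ _)).
  by rewrite -!mul2_compl hat_assoc.
split=> [/compatibleE e Z x|e].
- apply: (comp2_epi (mul2_iso (comp2_idl hB (𝟏 f)) (assocVK hB g f x))).
  apply: (comp2_epi (assocVK hB f (g · f) x)).
  by rewrite -hat_mul e rhoE.
- by apply/compatibleE/mul2_id1_injr; rewrite rhoE hat_mul e.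
Qed.

Lemma compatible_star (X Y Z : B)
    (f : cell1 X Y) (g : cell1 Y X) (eta : f · g ⇒ 𝕀 X) (rho : g · f ⇒ 𝕀 Y)
    (p : cell1 Y Z) (q : cell1 Z Y) (gamma : p · q ⇒ 𝕀 Y)
    (mu : q · p ⇒ 𝕀 Z) :
  compatible eta rho -> compatible gamma mu ->
  compatible (star eta gamma) (star mu rho).
Proof.
move=> /compatible_hatP er /compatible_hatP gm; apply/compatible_hatP=> T x.
apply: (comp2_mono (assocK hB f p x)).
rewrite assoc_natr !hat_star !(comp2A hB) -hat_nat er.
rewrite -!mul2_compl -!(comp2A hB); congr ((𝟏 f ⊠ _) ∘ _).
rewrite !mul2_compl !(comp2A hB); congr (_ ∘ _).
(* First the associator and then [hat rho (p · x)] move across the action of [gamma], which thus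
   ends up on [p · x], where [gm] applies. *)
rewrite -(comp2A hB _ (𝟏 g ⊠ _)) -hat_nat !(comp2A hB).
by rewrite -hat_nat gm.
Qed.

(** * Behaviour of [star] under 2-cells and constraints *)

Lemma star_nat (X Y Z : B)
    (f f' : cell1 X Y) (g g' : cell1 Y X) (eta' : f' · g' ⇒ 𝕀 X)
    (p p' : cell1 Y Z) (q q' : cell1 Z Y) (gamma' : p' · q' ⇒ 𝕀 Y)
    (a : f ⇒ f') (b : g ⇒ g') (c : p ⇒ p') (d : q ⇒ q') :
  star eta' gamma' ∘ ((a ⊠ c) ⊠ (d ⊠ b))
  = star (eta' ∘ (a ⊠ b)) (gamma' ∘ (c ⊠ d)).
Proof.
rewrite !starE (comp2_eq2 (assoc_nat hB _ _ _)) hat_comp; congr (_ ∘ _).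
rewrite -!(comp2A hB) -!(mul2_comp hB) (comp2_idl hB) (comp2_idr hB).
by rewrite (comp2A hB) -hat_nat -(comp2A hB) -!(mul2_comp hB)
  !(comp2_idl hB) (comp2_idr hB).
Qed.

Lemma star_assoc (X Y Z T : B)
    (f : cell1 X Y) (g : cell1 Y X) (eta : f · g ⇒ 𝕀 X)
    (p : cell1 Y Z) (q : cell1 Z Y) (gamma : p · q ⇒ 𝕀 Y)
    (u : cell1 Z T) (v : cell1 T Z) (theta : u · v ⇒ 𝕀 Z) :
  star eta (star gamma theta) ∘ (assoc f p u ⊠ assoc_inv v q g)
  = star (star eta gamma) theta.
Proof.
(* Moving [assoc_inv v q g] to the other side leaves only forward associators before passing to
   actions. *)
apply: (@comp2_epi _ _ _ _ _ _ _ (𝟏 _ ⊠ assoc v q g) (𝟏 _ ⊠ assoc_inv v q g)).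
  by apply: mul2_iso; rewrite ?(comp2_idl hB) ?(assocVK hB).
rewrite -(comp2A hB) -(mul2_comp hB) (assocK hB) (comp2_idr hB).
apply: hat_inj; rewrite !hat_comp !hat_star !(mul2_id hB).
rewrite !mul2_compl !(comp2A hB) ![in RHS](comp2_eq2 (assoc_natr _ _ _)).
rewrite [in RHS](comp2_eq3 (pentagon hB _ _ _ _)).
have e : (𝟏 f ⊠ assoc p u (v · q · (g · 𝕀 X)))
      ∘ (𝟏 f ⊠ (𝟏 (p · u) ⊠ assoc (v · q) g (𝕀 X)))
    = (𝟏 f ⊠ (𝟏 p ⊠ (𝟏 u ⊠ assoc (v · q) g (𝕀 X)))) ∘ (𝟏 f ⊠ assoc p u _).
  by rewrite -!mul2_compl assoc_natr.
rewrite (comp2_eq2 e); do 3 congr (_ ∘ _).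
rewrite -!(comp2A hB) -!mul2_compl; congr (_ ∘ (𝟏 f ⊠ (_ ∘ (𝟏 p ⊠ _)))).
rewrite (pentagon hB) !mul2_compl !(comp2A hB); congr (_ ∘ _ ∘ _).
by rewrite hat_nat.
Qed.

Lemma star_runit (X Y : B) (f : cell1 X Y) (g : cell1 Y X)
    (eta : f · g ⇒ 𝕀 X) :
  eta ∘ (runit f ⊠ lunit g) = star eta (runit (𝕀 Y)).
Proof.
(* One triangle gives this action; a second one absorbs the associator in [star]. *)
have hatE : hat (runit (𝕀 Y)) g = lunit g ∘ lunit (𝕀 Y · g).
  apply: (comp2_epi (assocVK hB (𝕀 Y) (𝕀 Y) g)).
  by rewrite hat_assoc -(triangle hB) !(comp2A hB) (lunit_nat hB).
rewrite starE hatE mul2_compl -!(comp2A hB) (triangle hB).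
by rewrite -mul2_swap -(mul2_comp hB) (comp2_idl hB) (comp2_idr hB).
Qed.

Lemma star_lunit (X Y : B) (f : cell1 X Y) (g : cell1 Y X)
    (eta : f · g ⇒ 𝕀 X) :
  eta ∘ (lunit f ⊠ runit g) = star (lunit (𝕀 X)) eta.
Proof.
have hatE : hat eta (𝕀 X) = eta ∘ (𝟏 f ⊠ runit g).
  apply: (comp2_epi (assocVK hB f g (𝕀 X))).
  by rewrite hat_assoc -(comp2A hB) runit_mul lunit_id1 (runit_nat hB).
rewrite starE (lunit_nat hB) hatE -!(comp2A hB) lunit_mul.
by rewrite -(mul2_comp hB) (comp2_idl hB) (comp2_idr hB).
Qed.

(** * Assembly of W(B) *)

Lemma is_wcell1E (X Y : B) (x : quad X Y) :
  is_wcell1 x <->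
  compatible (qrho x) (qeta x) /\ compatible (qeta x) (qrho x).
Proof. by split=> - [e1 e2]; split. Qed.

Lemma is_wcell2_inv (X Y : B) (x x' : quad X Y)
    (a : qf x ⇒ qf x') (b : qg x ⇒ qg x')
    (a' : qf x' ⇒ qf x) (b' : qg x' ⇒ qg x) :
  a ∘ a' = 𝟏 (qf x') -> b ∘ b' = 𝟏 (qg x') ->
  is_wcell2 a b -> is_wcell2 a' b'.
Proof.
move=> aK bK [ea eb]; split; rewrite -?ea -?eb -(comp2A hB) mul2_iso //.
all: exact: comp2_idr.
Qed.

(** By proof irrelevance, each axiom of W(B) splits into two equations in [B]. *)
Lemma wcell2_eq (X Y : B) (x x' : wcell1 X Y) (s t : wcell2 x x') :
  wa s = wa t -> wb s = wb t -> s = t.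
Proof.
case: s t => [a b s] [a' b' t] /= ea eb; subst a' b'.
by rewrite (proof_irrelevance _ s t).
Qed.

Lemma W_closedP : W_closed B.
Proof.
have assocP (X Y Z T : B) (x : wcell1 X Y) (y : wcell1 Y Z) (z : wcell1 Z T) :
    is_wcell2 (x := quad_mul (quad_mul x y) z)
      (x' := quad_mul x (quad_mul y z))
      (assoc (qf x) (qf y) (qf z)) (assoc_inv (qg z) (qg y) (qg x)).
  split=> /=; first exact: star_assoc.
  (* The order of the factors is reversed for [qrho], so [star_assoc] is used backwards and its
     associators cancel. *)
  rewrite -star_assoc -(comp2A hB) mul2_iso ?(comp2_idr hB) //.
    exact: assocVK.
  exact: assocK.
have runitP (X Y : B) (x : wcell1 X Y) :
    is_wcell2 (x := quad_mul x (quad_id Y)) (x' := x)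
      (runit (qf x)) (lunit (qg x)).
  by split=> /=; [exact: star_runit | exact: star_lunit].
have lunitP (X Y : B) (x : wcell1 X Y) :
    is_wcell2 (x := quad_mul (quad_id X) x) (x' := x)
      (lunit (qf x)) (runit (qg x)).
  by split=> /=; rewrite ?star_lunit ?star_runit lunit_id1.
split=> //.
- move=> X; apply/is_wcell1E; rewrite /compatible /= lunit_id1.
  by rewrite -(comp2A hB) -(triangle hB) lunit_id1.
- move=> X Y Z x y; apply/is_wcell1E.
  case: (wcell1P x) (wcell1P y) => [x1 x2] [y1 y2].
  by split; apply: compatible_star.
- by move=> X Y x; split; rewrite (mul2_id hB) (comp2_idr hB).
- move=> X Y x y z t s; case: (wcell2P t) (wcell2P s) => [t1 t2] [s1 s2].
  by split; rewrite (mul2_comp hB) (comp2A hB) ?t1 ?t2.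
- move=> X Y Z x x' y y' s t.
  case: (wcell2P t) (wcell2P s) => [t1 t2] [s1 s2].
  by split=> /=; rewrite star_nat ?s1 ?s2 ?t1 ?t2.
- move=> X Y Z T x y z; apply: is_wcell2_inv (assocP X Y Z T x y z).
    exact: assocVK.
  exact: assocK.
- move=> X Y x; apply: is_wcell2_inv (runitP X Y x).
    exact: runitVK.
  exact: lunitVK.
- move=> X Y x; apply: is_wcell2_inv (lunitP X Y x).
    exact: lunitVK.
  exact: runitVK.
Qed.

Lemma W_is_bicategory : is_bicategory (W_data W_closedP).
Proof.
(* All first components are axioms of [B]. Three second components remain, those involving
   [assoc_inv]: naturality, pentagon and triangle. *)
split=> *; apply: wcell2_eq => /=; try by apply hB.
- exact: assoc_inv_nat.
- exact: pentagon_inv.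
- by rewrite -(triangle hB) (comp2_eq1 (assocVK hB _ _ _)) (comp2_idr hB).
Qed.

End Coherence.

Theorem proposition1p9 (B : bicategory) :
  exists H : W_closed B, is_bicategory (W_data H).
Proof.
exists (W_closedP (bicategoryP B)); exact: W_is_bicategory.
Qed.
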